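(* Let $n$ and $k$ be positive integers and let $m=n^k$. Then there is a set $M$ with $|M|=m$ and a function $f:\binom{M}{k}\to\binom{M}{k!}$ such that $X\cap f(X)=\emptyset$ for all $X\in\binom{M}{k}$, and every $P\subset M$ with $|P|>k^2n$ contains a $k$-element set $X\subset P$ such that $f(X)\cap P\neq\emptyset$.
   Context: For a set $M$ and an integer $j$, $\binom{M}{j}$ denotes the family of all $j$-element subsets of $M$.
   Formalization: The formal statement adds the assumption that n^k < k or n^k ≥ k + k!; in the excluded cases (e.g. n = k = 1, or n = 2, k = 3) k-element sets X exist but no k!-element subset of M is disjoint from X, so no such f exists. *)

(* Defs.v *)
From mathcomp Require Import all_boot.
Set Implicit Arguments.
Unset Strict Implicit.
Unset Printing Implicit Defensive.

Definition ksubset (M : finType) (j : nat) := {X : {set M} | #|X| == j}.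

(* A map f with X and f X always disjoint exists only if M has no k-element   *)
(* subset, or the complement of a k-element subset has room for k! elements.  *)
(* This fails for #|M| = n ^ k when, e.g., (n, k) = (1, 1) or (2, 3), so the  *)
(* size condition has to be a hypothesis.                                     *)
Lemma disjoint_map_room (M : finType) (k : nat)
    (f : ksubset M k -> ksubset M k`!) :
  (forall X, val X :&: val (f X) = set0) -> #|M| < k \/ k + k`! <= #|M|.
Proof.
move=> fD; have [|leKM] := ltnP #|M| k; [by left | right].
have [A /andP[_ /eqP cA]] :
    exists A : {set M}, (A \subset [set: M]) && (#|A| == k).
  by apply/card_gt0P; rewrite -cardsE cards_draws cardsT bin_gt0.
pose X : ksubset M k := Sub A (introT eqP cA).
rewrite -{1}(eqP (valP X)) -(eqP (valP (f X))).
by rewrite -cardsUI fD cards0 addn0 max_card.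
Qed.

(* Main.v *)
(** Take M = C^I with |I| = k and |C| = n.  Let f X contain every point outside
    X of the form i |-> g(i)(i), where g : I -> X is injective; there are at
    most k! of them.  If P has more than k^2 n points, discard from P every
    hyperplane section {x in P | x(i) = c} with at most k points: there are
    k n hyperplanes, so some y in P survives, and the k sections of P through y
    have at least k points each besides y.  Greedily choosing distinct g(i) <> y
    in P with g(i)(i) = y(i) gives a k-set X in P with y in f X. *)
Require Import Defs.
From mathcomp Require Import all_boot.

Lemma leq_card_bigcup {I : Type} {T : finType} (r : seq I) (Q : pred I)
    (A : I -> {set T}) :
  #|\bigcup_(i <- r | Q i) A i| <= \sum_(i <- r | Q i) #|A i|.
Proof.
elim/big_rec2: _ => [|i m B _ leB]; first by rewrite cards0.
by apply: leq_trans (leq_card_setU _ _) _; rewrite leq_add2l.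
Qed.

Lemma exists_set_between {T : finType} {A B : {set T}} {j : nat} :
    A \subset B -> #|A| <= j <= #|B| ->
  exists Z : {set T}, [/\ A \subset Z, Z \subset B & #|Z| = j].
Proof.
move=> sAB /andP[leAj lejB].
have [D /andP[sDBA /eqP cD]] :
    exists D : {set T}, (D \subset B :\: A) && (#|D| == j - #|A|).
  by apply/card_gt0P; rewrite -cardsE cards_draws bin_gt0 cardsDS ?leq_sub2r.
have [sDB dDA] := subsetDP sDBA.
exists (A :|: D); rewrite subsetUl subUset sAB sDB; split=> //.
by rewrite cardsU disjoint_setI0 1?disjoint_sym // cards0 subn0 cD subnKC.
Qed.

Lemma distinct_representatives {T : finType} {k : nat} (A : 'I_k -> {set T}) :
    (forall i : 'I_k, i < #|A i|) ->
  exists2 g : 'I_k -> T, injective g & forall i, g i \in A i.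
Proof.
elim: k A => [|k IHk] A ltA; first by exists (ffun0 (card_ord 0)) => -[].
have [|g g_inj gA] := IHk (fun i => A (lift ord_max i)).
  by move=> i; have:= ltA (lift ord_max i); rewrite lift_max.
have /subsetPn[x Ax g'x] : ~~ (A ord_max \subset g @: 'I_k).
  apply: contraL (ltA ord_max) => /subset_leq_card leA.
  by rewrite -leqNgt (leq_trans leA) // card_imset ?card_ord.
have neq_gx i : g i <> x by move=> gi; rewrite -gi imset_f in g'x.
exists (fun i => if unlift ord_max i is Some j then g j else x).
  move=> i j; case: unliftP => [i'|] ->; case: unliftP => [j'|] -> //.
  - by move=> /g_inj->.
  - by move=> /neq_gx.
  - by move=> /esym/neq_gx.
by move=> i; case: unliftP => [i'|] ->.
Qed.

Lemma exists_large_fibers {I C T : finType} (c : I -> T -> C) {b : nat}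
    {P : {set T}} :
    #|I| * #|C| * b < #|P| ->
  exists2 y, y \in P & forall i, b < #|[set x in P | c i x == c i y]|.
Proof.
pose fiber (p : I * C) := [set x in P | c p.1 x == p.2].
pose small := \bigcup_(p | #|fiber p| <= b) fiber p.
have le_small : #|small| <= #|I| * #|C| * b.
  rewrite -card_prod -sum_nat_const (leq_trans (leq_card_bigcup _ _ _)) //.
  by rewrite big_mkcond leq_sum // => p _; case: ifP.
move=> ltP; have /subsetPn[y Py small'y] : ~~ (P \subset small).
  apply: contraTN ltP => /subset_leq_card leP.
  by rewrite -leqNgt (leq_trans leP).
exists y => // i; rewrite ltnNge; apply: contra small'y => le_b.
by apply/bigcupP; exists (i, c i y); rewrite // inE Py eqxx.
Qed.

Lemma exists_disjoint_map {T : finType} {j k : nat} {F : {set T} -> {set T}} :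
    (forall X : {set T}, #|X| = k -> #|F X| <= j) ->
    #|T| < k \/ k + j <= #|T| ->
  exists2 f : ksubset T k -> ksubset T j,
    forall X, val X :&: val (f X) = set0
  & forall X, F (val X) :\: val X \subset val (f X).
Proof.
move=> leF room.
suff /fin_all_exists2 : forall X : ksubset T k,
    exists2 Z : ksubset T j, val X :&: val Z = set0
                           & F (val X) :\: val X \subset val Z by [].
move=> X; have cX := eqP (valP X).
have leXT : k <= #|T| by rewrite -cX max_card.
have lejC : j <= #|~: val X|.
  case: room => [|leT]; first by rewrite ltnNge leXT.
  by rewrite cardsCs setCK cX leq_subRL.
have leFj : #|F (val X) :\: val X| <= j.
  by rewrite (leq_trans (subset_leq_card (subsetDl _ _))) ?leF.
have sFC : F (val X) :\: val X \subset ~: val X by rewrite setDE subsetIr.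
have [|Z [sFZ sZC cZ]] := exists_set_between sFC (j := j).
  by rewrite leFj.
exists (Sub Z (introT eqP cZ)) => //.
by apply/disjoint_setI0; rewrite disjoint_sym disjoints_subset.
Qed.

Section Diagonals.

Context {I C : finType}.
Implicit Types X P : {set {ffun I -> C}}.

Definition diagonal (g : {ffun I -> {ffun I -> C}}) : {ffun I -> C} :=
  [ffun i => g i i].

Definition diagonals X : {set {ffun I -> C}} :=
  [set diagonal g | g in [pred g in ffun_on X | injectiveb g]].

Lemma leq_card_diagonals X : #|diagonals X| <= #|X| ^_ #|I|.
Proof. by rewrite -card_inj_ffuns_on cardsE leq_imset_card. Qed.

Lemma diagonal_in_diagonals (g : I -> {ffun I -> C}) :
  injective g -> diagonal (finfun g) \in diagonals (g @: I).
Proof.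
move=> g_inj; apply: imset_f; rewrite inE; apply/andP; split.
  by apply/ffun_onP => i; rewrite ffunE imset_f.
by apply/injectiveP => i j; rewrite !ffunE => /g_inj.
Qed.

Lemma exists_subset_diagonal P :
    #|I| ^ 2 * #|C| < #|P| ->
  exists X y, [/\ X \subset P, #|X| = #|I|, y \in P & y \in diagonals X :\: X].
Proof.
rewrite -mulnn mulnAC => ltP; pose coord i (x : {ffun I -> C}) := x i.
have [y Py lt_fiber] := exists_large_fibers coord ltP.
pose A i := [set x in P | x i == y i] :\ y.
have leA i : #|I| <= #|A i|.
  by rewrite -ltnS (leq_trans (lt_fiber i)) // (cardsD1 y) inE Py eqxx.
have [|h h_inj hA] := distinct_representatives (A \o @enum_val I I).
  by move=> r; apply: leq_trans (ltn_ord r) (leA _).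
pose g := h \o enum_rank.
have g_inj : injective g := inj_comp h_inj enum_rank_inj.
have gA i : [/\ g i != y, g i \in P & g i i = y i].
  have := hA (enum_rank i).
  by rewrite /= enum_rankK !inE => /and3P[-> -> /eqP].
have y_diag : y = diagonal (finfun g).
  by apply/ffunP => i; rewrite !ffunE; case: (gA i).
exists (g @: I), y; split=> //; [|by rewrite card_imset|].
  by apply/subsetP => _ /imsetP[i _ ->]; case: (gA i).
rewrite inE {2}y_diag diagonal_in_diagonals // andbT.
by apply/imsetP => -[i _ y_gi]; case: (gA i); rewrite -y_gi eqxx.
Qed.

End Diagonals.

Theorem theorem2p1 (n k : nat) (n_gt0 : 0 < n) (k_gt0 : 0 < k)
    (k_room : n ^ k < k \/ k + k`! <= n ^ k) :
  exists (M : finType) (f : ksubset M k -> ksubset M k`!),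
    [/\ #|M| = n ^ k,
        forall X : ksubset M k, val X :&: val (f X) = set0
      & forall P : {set M}, k ^ 2 * n < #|P| ->
          exists X : ksubset M k,
            val X \subset P /\ val (f X) :&: P <> set0].
Proof.
pose M : finType := {ffun 'I_k -> 'I_n}.
have cM : #|M| = n ^ k by rewrite card_ffun !card_ord.
have le_diag (X : {set M}) : #|X| = k -> #|diagonals X| <= k`!.
  by move=> cX; have:= leq_card_diagonals X; rewrite cX card_ord ffactnn.
have [|f f_disj f_diag] := exists_disjoint_map le_diag; first by rewrite cM.
exists M, f; split=> // P ltP.
have [|X [y [sXP cX Py y_diag]]] := @exists_subset_diagonal _ _ P.
  by rewrite !card_ord.
rewrite card_ord in cX; exists (Sub X (introT eqP cX)); split=> //.
apply/eqP/set0Pn; exists y; rewrite inE Py andbT.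
exact: (subsetP (f_diag _)).
Qed.
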